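(* Let $X$ be a roughly geodesic hyperbolic space, with an (isometric) action of a group $G$. If $X$ has strong quasitree rank $m<\infty$ (with respect to $G$), then there is some constant $R$ such that the pair $(G,X)$ admits globally $(2m+1,R)$-stable cylinders; that is, for some $\theta$ there is a $G$-invariant, globally $(2m+1,R)$-stable choice of $\theta$-cylinders on $X$.
   Context: A $k$-rough geodesic in a metric space is a $(1,k)$-quasiisometrically embedded path; a metric space is $k$-roughly geodesic if any two points are joined by a $k$-rough geodesic, and roughly geodesic if this holds for some $k$. A quasitree is a metric space quasiisometric to a tree. Coarse medians. If $X$ is a roughly geodesic hyperbolic space, then for each triple $x,y,z\in X$ there is a uniformly bounded set of points uniformly close to all three sides of every (uniform-quality) rough geodesic triangle with vertices $x,y,z$; a coarse median $\mu_X:X^3\to X$ is an (equivariant) choice of point in this set for each triple. On a product of hyperbolic spaces (with the $\ell^1$ metric) the coarse median is defined componentwise. A map $f:(X,\mu_X)\to(Y,\mu_Y)$ is quasimedian if there is $\delta$ with $d_Y\big(\mu_Y(f(x),f(y),f(z)),f(\mu_X(x,y,z))\big)\le\delta$ for all $x,y,z\in X$. The strong quasitree rank of $(X,G)$ is the infimal $m$ such that there exists a $G$-equivariant, quasimedian, quasiisometric embedding of $X$ in a product of $m$ quasitrees (on which $G$ acts by isometries). Cylinders. Let $X$ be a $\delta$-roughly geodesic hyperbolic space. For $\theta\ge0$ and $x,y\in X$, a $\theta$-cylinder is a subset $C(x,y)\subset X$ such that $\gamma_{xy}\subset C(x,y)\subset \mathcal N_\theta(\gamma_{xy})$ (the $\theta$-neighbourhood)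 for every $\delta$-rough geodesic $\gamma_{xy}$ from $x$ to $y$. A choice of $\theta$-cylinder $C(x,y)$ for each $x,y\in X$ is globally $(k,R)$-stable if: (1) $C(x,y)=C(y,x)$ for all $x,y$; (2) for each $x,y,z\in X$ there exist balls $B_1,\dots,B_k$ of radius $R$ such that $$C(x,y)\cap B(x,\langle y,z\rangle_x)\smallsetminus\bigcup_{i=1}^k B_i = C(x,z)\cap B(x,\langle y,z\rangle_x)\smallsetminus\bigcup_{i=1}^k B_i,$$ where $\langle y,z\rangle_x$ is the Gromov product and $B(x,\rho)$ the $\rho$-ball centred on $x$. The choice is $G$-invariant if $C(gx,gy)=gC(x,y)$ for all $x,y\in X$ and $g\in G$. *)

(* Defs.v *)
From HB Require Import structures.
From mathcomp Require Import all_boot all_order all_algebra.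
From mathcomp Require Import all_classical all_reals all_analysis.

Set Implicit Arguments.
Unset Strict Implicit.
Unset Printing Implicit Defensive.

Import Order.TTheory GRing.Theory Num.Theory.
Import numFieldNormedType.Exports.

Local Open Scope classical_set_scope.
Local Open Scope ring_scope.

(* The library's [ball] is open (and empty when the radius is 0) and its
   [closed_ball] is a topological closure; balls and neighbourhoods here are
   metrically closed, so that theta = 0 is allowed in theta-cylinders. *)
Definition mball (R : realType) (X : metricType R) (x : X) (r : R) : set X :=
  [set p | mdist x p <= r].

Definition mnbhd (R : realType) (X : metricType R) (r : R) (A : set X) : set X :=
  [set p | exists2 q, A q & mdist p q <= r].

Definition gromov_product (R : realType) (X : metricType R) (w x y : X) : R :=
  (mdist w x + mdist w y - mdist x y) / 2.

Definition hyperbolic (R : realType) (X : metricType R) : Prop :=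
  exists d : R, forall w x y z : X,
    Num.min (gromov_product w x y) (gromov_product w y z) - d
      <= gromov_product w x z.

Definition qi_embedding_on (R : realType) (X Y : metricType R) (A : set X)
    (l c : R) (f : X -> Y) : Prop :=
  forall s t, A s -> A t ->
    l^-1 * mdist s t - c <= mdist (f s) (f t) <= l * mdist s t + c.

Definition qi_embedding (R : realType) (X Y : metricType R) (f : X -> Y) : Prop :=
  exists l c : R, [/\ 1 <= l, 0 <= c & qi_embedding_on setT l c f].

Definition quasiisometric (R : realType) (X Y : metricType R) : Prop :=
  exists2 f : X -> Y, qi_embedding f & exists c : R, mnbhd c (range f) = setT.

(* [S] is the image of a (not necessarily continuous) [k]-rough geodesic path
   from [x] to [y]. *)
Definition rough_geodesic (R : realType) (X : metricType R) (k : R) (x y : X)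
    (S : set X) : Prop :=
  exists (L : R^o) (g : R^o -> X),
    [/\ 0 <= L, g 0 = x, g L = y, qi_embedding_on (`[0, L] : set R^o) 1 k g &
        S = g @` `[0, L]].

Definition roughly_geodesic_with (R : realType) (k : R) (X : metricType R) : Prop :=
  forall x y : X, exists S, rough_geodesic k x y S.

Definition roughly_geodesic (R : realType) (X : metricType R) : Prop :=
  exists k : R, roughly_geodesic_with k X.

(* [T] is the vertex set, with the path metric, of a simplicial tree: a graph in
   which any two vertices are joined by a unique simple path. *)
Definition is_tree (R : realType) (T : metricType R) : Prop :=
  exists e : rel T,
    [/\ symmetric e, irreflexive e,
        forall x y, exists! p : seq T,
          [/\ path e x p, uniq (x :: p) & last x p = y] &
        forall x (p : seq T), path e x p -> uniq (x :: p) ->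
          mdist x (last x p) = (size p)%:R].

Definition quasitree (R : realType) (X : metricType R) : Prop :=
  exists2 T : metricType R, is_tree T & quasiisometric X T.

Definition l1_prod (R : realType) (m : nat) (Q : 'I_m -> metricType R) : Type :=
  forall i, Q i.

Section L1Metric.
Variables (R : realType) (m : nat) (Q : 'I_m -> metricType R).

HB.instance Definition _ := gen_eqMixin (l1_prod Q).
HB.instance Definition _ := gen_choiceMixin (l1_prod Q).

Definition l1_dist (p q : l1_prod Q) : R := \sum_(i < m) mdist (p i) (q i).

Let l1_distxx p : l1_dist p p = 0.
Proof. by apply: big1 => i _; rewrite mdistxx. Qed.

Let l1_dist_positivity p q : l1_dist p q = 0 -> p = q.
Proof.
move=> /eqP; rewrite psumr_eq0; last by move=> i _; exact: mdist_ge0.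
move=> /allP pq0; apply: functional_extensionality_dep => i.
by apply: mdist_positivity; apply/eqP; exact: (pq0 i (mem_index_enum i)).
Qed.

Let l1_dist_sym p q : l1_dist p q = l1_dist q p.
Proof. by apply: eq_bigr => i _; exact: metric_sym. Qed.

Let l1_dist_triangle q p r : l1_dist p r <= l1_dist p q + l1_dist q r.
Proof.
by rewrite -big_split; apply: ler_sum => i _; exact: metric_triangle.
Qed.

HB.instance Definition _ := isMetric.Build R (l1_prod Q)
  l1_distxx l1_dist_positivity l1_dist_sym l1_dist_triangle.

End L1Metric.

Record isometric_action (R : realType) (G : groupType) (X : metricType R) :=
  IsometricAction {
    iact :> G -> X -> X ;
    iact1 : forall x, iact 1%g x = x ;
    iactM : forall g h x, iact (g * h)%g x = iact g (iact h x) ;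
    iact_isometry : forall g x y, mdist (iact g x) (iact g y) = mdist x y
  }.

(* Meant for [X] roughly geodesic and hyperbolic, where a coarse median exists
   and any two are at bounded distance from each other. *)
Definition coarse_median (R : realType) (X : metricType R)
    (mu : X -> X -> X -> X) : Prop :=
  forall k : R, exists D : R, forall (x y z : X) (Sxy Syz Sxz : set X),
    rough_geodesic k x y Sxy -> rough_geodesic k y z Syz ->
    rough_geodesic k x z Sxz ->
    [/\ mnbhd D Sxy (mu x y z), mnbhd D Syz (mu x y z) &
        mnbhd D Sxz (mu x y z)].

Definition l1_median (R : realType) (m : nat) (Q : 'I_m -> metricType R)
    (mu : forall i, Q i -> Q i -> Q i -> Q i) (p q r : l1_prod Q) : l1_prod Q :=
  fun i => mu i (p i) (q i) (r i).

Definition quasimedian (R : realType) (X Y : metricType R)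
    (muX : X -> X -> X -> X) (muY : Y -> Y -> Y -> Y) (f : X -> Y) : Prop :=
  exists d : R, forall x y z,
    mdist (muY (f x) (f y) (f z)) (f (muX x y z)) <= d.

(* The quasitrees are required to be roughly geodesic, hence hyperbolic, as this
   is what gives sense to their coarse medians. The group acts on the product,
   possibly permuting the factors. *)
Definition strong_quasitree_embedding (R : realType) (G : groupType)
    (X : metricType R) (aX : isometric_action G X) (m : nat) : Prop :=
  exists (Q : 'I_m -> metricType R) (aQ : isometric_action G (l1_prod Q))
         (muX : X -> X -> X -> X) (muQ : forall i, Q i -> Q i -> Q i -> Q i)
         (f : X -> l1_prod Q),
    [/\ forall i, quasitree (Q i) /\ roughly_geodesic (Q i),
        coarse_median muX /\ (forall i, coarse_median (muQ i)),
        forall g x, f (aX g x) = aQ g (f x),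
        quasimedian muX (l1_median muQ) f &
        qi_embedding f].

(* Equal to +oo when there is no such embedding. *)
Definition strong_quasitree_rank (R : realType) (G : groupType)
    (X : metricType R) (aX : isometric_action G X) : \bar R :=
  ereal_inf [set (m%:R)%:E | m in strong_quasitree_embedding aX].

Definition is_cylinder (R : realType) (X : metricType R) (delta theta : R)
    (x y : X) (C : set X) : Prop :=
  forall S, rough_geodesic delta x y S -> S `<=` C /\ C `<=` mnbhd theta S.

Definition globally_stable (R : realType) (X : metricType R) (k : nat) (r : R)
    (C : X -> X -> set X) : Prop :=
  (forall x y, C x y = C y x) /\
  (forall x y z, exists c : 'I_k -> X,
    (C x y `&` mball x (gromov_product x y z)) `\` (\bigcup_i mball (c i) r) =
    (C x z `&` mball x (gromov_product x y z)) `\` (\bigcup_i mball (c i) r)).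

Definition invariant_cylinders (R : realType) (G : groupType)
    (X : metricType R) (aX : isometric_action G X) (C : X -> X -> set X) : Prop :=
  forall g x y, C (aX g x) (aX g y) = aX g @` C x y.

(* Main.v *)
(* Write [f_i] for the components of the given embedding [f : X -> prod_i Q_i] and
   let [phi] range over the maps [x |-> f_i (g x)], with [g] in [G].  The cylinder
   [C x y] consists, besides two balls at [x] and [y], of the points [p] having
   nearby points [p1], [p2] whose images under some [phi] are separated by a ball
   about some [s] in the quasitree, with [phi x] on the side of [phi p1] and
   [phi y] on the side of [phi p2].  Sides are chain components of complements of
   balls, and by the bottleneck property of quasitrees they agree coarsely with
   what the Gromov products see.  Points of geodesics are separated in this way
   because [f] is a quasiisometric embedding; conversely a point with this property
   is close to the geodesics because [phi] preserves coarse betweenness.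

   If [p] lies in [C x y] but not in [C x z], then [s] separates [y] from [z], and
   so sits just before the centre [c] of [xyz] as seen by [phi].  So either [p] is
   near [c], or [p] is near the point where [phi] of the geodesic from [x] to [c]
   reaches [phi c] for good.  An isometry of the l1-product permutes the unbounded
   factors up to a bounded error, so that there are at most [m] such points up to
   bounded distance, and [m + 1 <= 2m + 1] balls suffice. *)
Require Import Defs.
From mathcomp Require Import all_boot all_order all_algebra.
From mathcomp Require Import all_classical all_reals all_analysis.
From mathcomp Require Import lra.

Set Implicit Arguments.
Unset Strict Implicit.
Unset Printing Implicit Defensive.

Import Order.TTheory GRing.Theory Num.Theory.

Local Open Scope classical_set_scope.
Local Open Scope ring_scope.

(** * Gromov products and trees *)

Local Notation gp := gromov_product.

Section GromovProduct.
Variables (R : realType) (X : metricType R).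
Implicit Types (w x y z : X).

Lemma gpC w x y : gp w x y = gp w y x.
Proof. by rewrite /gp (metric_sym x y) (addrC (mdist w x)). Qed.

Lemma gp_ge0 w x y : 0 <= gp w x y.
Proof.
rewrite /gp; have := metric_triangle x w y; rewrite (metric_sym x w); lra.
Qed.

Lemma gpDl w x y : gp w x y + gp x w y = mdist w x.
Proof. by rewrite /gp (metric_sym x w); lra. Qed.

Lemma gp_le_distl w x y : gp w x y <= mdist w x.
Proof. by have := gpDl w x y; have := gp_ge0 x w y; lra. Qed.

Lemma gp_le_distr w x y : gp w x y <= mdist w y.
Proof. by rewrite gpC gp_le_distl. Qed.

Lemma gp_base w z x y : gp w x y <= gp z x y + mdist w z.
Proof.
rewrite /gp; have := metric_triangle w z x; have := metric_triangle w z y; lra.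
Qed.

Lemma gp_move w x y z : gp w x y <= gp w x z + mdist y z.
Proof.
rewrite /gp; have := metric_triangle w z y; have := metric_triangle x y z.
by rewrite (metric_sym z y); lra.
Qed.

Lemma gpxx w x : gp w x x = mdist w x.
Proof. by rewrite /gp mdistxx; lra. Qed.

Lemma gp_same x y : gp x x y = 0.
Proof. by rewrite /gp mdistxx; lra. Qed.

Lemma dist_gp w x y : mdist x y = mdist w x + mdist w y - 2 * gp w x y.
Proof. by rewrite /gp; lra. Qed.

End GromovProduct.

(** The four-point condition as a disjunction, so that each use is a case split followed by linear
    arithmetic. *)
Definition gp_hyperbolic (R : realType) (X : metricType R) (d : R) :=
  forall w x y z : X, gp w x y - d <= gp w x z \/ gp w y z - d <= gp w x z.

Lemma hyperbolic_gp (R : realType) (X : metricType R) :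
  hyperbolic X -> exists2 d, 0 <= d & gp_hyperbolic X d.
Proof.
move=> [d Hd]; exists `|d| => // w x y z.
have := Hd w x y z; rewrite /Num.min; have := ler_norm d.
by case: ifP => _; [left|right]; lra.
Qed.

Section Tree.
Variables (R : realType) (T : metricType R) (e : rel T).
Hypotheses (e_sym : symmetric e)
  (e_path : forall x y, exists! p : seq T,
     [/\ path e x p, uniq (x :: p) & last x p = y])
  (e_dist : forall x (p : seq T), path e x p -> uniq (x :: p) ->
     mdist x (last x p) = (size p)%:R).

Let simple x p := path e x p /\ uniq (x :: p).

Lemma simple_path_unique x p q : simple x p -> simple x q ->
  last x p = last x q -> p = q.
Proof.
move=> [ep up] [eq uq] pq; have [r [_ Hr]] := e_path x (last x p).
by rewrite -(Hr p) // -(Hr q).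
Qed.

Lemma simple_catl x p q : simple x (p ++ q) -> simple x p.
Proof.
by move=> []; rewrite cat_path -cat_cons cat_uniq => /andP[? _] /and3P[? _ _].
Qed.

Lemma simple_catr x p q : simple x (p ++ q) -> simple (last x p) q.
Proof.
move=> []; rewrite cat_path => /andP[_ eq].
by rewrite -cat_cons lastI cat_rcons cat_uniq => /and3P[].
Qed.

(** Cut at a common vertex, both paths become simple paths with the same ends, hence equal. *)
Lemma simple_branch_disjoint x p q v :
  simple x p -> simple x q -> v \in p -> v \in q -> head x p = head x q.
Proof.
move=> sp sq vp vq; move: sp sq; case/path.splitP: vp => p1 p2.
case/path.splitP: vq => q1 q2.
move=> /simple_catl sp /simple_catl sq.
have: rcons p1 v = rcons q1 v.
  by apply: (simple_path_unique sp sq); rewrite !last_rcons.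
by move=> /(congr1 (head x)); case: p1 {sp} => [|a p1]; case: q1 {sq} => [|b q1].
Qed.

(** The reverse of [p] followed by [q] is itself a simple path, since the branches are disjoint. *)
Lemma simple_branch_dist x p q : simple x p -> simple x q ->
  (p == [::]) || (q == [::]) || (head x p != head x q) ->
  mdist (last x p) (last x q) = (size p + size q)%:R.
Proof.
move=> sp sq; have [->|p0] := eqVneq p [::].
  by move=> _; rewrite add0n e_dist //; case: sq.
have [->|q0] := eqVneq q [::].
  by move=> _; rewrite addn0 metric_sym e_dist //; case: sp.
rewrite /= => pq.
have [ep up] := sp; have [eq uq] := sq.
have lx : last (last x p) (rev (belast x p)) = x.
  by case: (p) p0 => //= a s _; rewrite rev_cons last_rcons.
have -> : last x q = last (last x p) (rev (belast x p) ++ q).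
  by rewrite last_cat lx.
rewrite e_dist ?size_cat ?size_rev ?size_belast //.
  rewrite cat_path lx eq andbT rev_path.
  by rewrite (@eq_path _ _ e) // => a b; rewrite e_sym.
have -> : last x p :: rev (belast x p) ++ q = rev (x :: p) ++ q.
  by rewrite -cat_cons -rev_rcons -lastI.
rewrite cat_uniq rev_uniq up /=; apply/andP; split; last by case/andP: uq.
apply/hasPn => v vq; rewrite mem_rev inE negb_or; apply/andP; split.
  by apply: contraTneq vq => ->; case/andP: uq.
by apply: contra pq => vp; apply/eqP/(simple_branch_disjoint sp sq vp vq).
Qed.

Lemma simple_fork x p q : simple x p -> simple x q ->
  exists c a b, [/\ p = c ++ a, q = c ++ b &
    mdist (last x p) (last x q) = (size a + size b)%:R].
Proof.
elim: p x q => [|v p IH] x q sp sq.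
  by exists [::], [::], q; split=> //; exact: simple_branch_dist.
case: q sq => [|w q] sq.
  by exists [::], (v :: p), [::]; split=> //; exact: simple_branch_dist.
have [vw|vw] := eqVneq v w; last first.
  by exists [::], (v :: p), (w :: q); split=> //; apply: simple_branch_dist.
rewrite -vw in sq *.
have sp' : simple v p := @simple_catr x [:: v] p sp.
have sq' : simple v q := @simple_catr x [:: v] q sq.
have [c [a [b [-> -> H]]]] := IH v q sp' sq'.
by exists (v :: c), a, b.
Qed.

(** The Gromov product at [w] is the length of the common prefix of two simple paths. Two prefixes
    of the path to [y] are nested, so the shorter one is shared by the paths to [x] and [z]. *)
Lemma tree_gp_hyperbolic : gp_hyperbolic T 0.
Proof.
move=> w x y z.
have [p [[ep up lp] _]] := e_path w x.
have [q [[eq uq lq] _]] := e_path w y.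
have [r [[er ur lr] _]] := e_path w z.
have dp := e_dist ep up; have dq := e_dist eq uq; have dr := e_dist er ur.
have [c [a [b [pca qcb dpq]]]] := simple_fork (conj ep up) (conj eq uq).
have [c' [a' [b' [qca rcb dqr]]]] := simple_fork (conj eq uq) (conj er ur).
have gpc (s s' t t' u : seq T) : simple w (u ++ s) -> simple w (u ++ s') ->
   (size u)%:R <= gp w (last w (u ++ s)) (last w (u ++ s')).
  move=> [es us] [es' us'].
  rewrite /gp (e_dist es us) (e_dist es' us').
  have := metric_triangle (last w (u ++ s)) (last w u) (last w (u ++ s')).
  rewrite !last_cat (metric_sym _ (last w u)).
  have [? ?] := simple_catr (conj es us).
  have [? ?] := simple_catr (conj es' us').
  rewrite !e_dist // !size_cat !natrD; lra.
have g1 : gp w x y = (size c)%:R.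
  by rewrite /gp -lp -lq dp dq dpq pca qcb !size_cat !natrD; lra.
have g2 : gp w y z = (size c')%:R.
  by rewrite /gp -lq -lr dq dr dqr qca rcb !size_cat !natrD; lra.
rewrite g1 g2 !subr0 -lp -lr pca rcb.
have cc : c ++ b = c' ++ a' by rewrite -qcb.
have [le_cc|le_cc] := leqP (size c) (size c').
  left; have [u cu] : exists u, c' = c ++ u.
    exists (drop (size c) c').
    have := congr1 (take (size c)) cc; rewrite take_size_cat // takel_cat //.
    by move=> {1}->; rewrite cat_take_drop.
  rewrite cu -catA; apply: gpc => //; first by rewrite -pca.
  by rewrite catA -cu -rcb.
right; have [u cu] : exists u, c = c' ++ u.
  exists (drop (size c') c).
  have := congr1 (take (size c')) cc; rewrite takel_cat 1?ltnW // take_size_cat //.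
  by move=> {1}<-; rewrite cat_take_drop.
rewrite cu -catA; apply: gpc => //; last by rewrite -rcb.
by rewrite catA -cu -pca.
Qed.

End Tree.

(** * Chains of bounded steps *)

Section Linked.
Variables (R : realType) (X : metricType R).
Implicit Types (A B : set X) (k : R).

(** A substitute for connectedness in possibly discrete spaces. Unlike a lower bound on Gromov
    products, it is transitive without any loss. *)
Inductive linked k A : X -> X -> Prop :=
| linked_refl x : A x -> linked k A x x
| linked_step x y z : A x -> mdist x y <= k -> linked k A y z -> linked k A x z.

Lemma linked_in k A x y : linked k A x y -> A x /\ A y.
Proof. by elim=> // {}x {}y z Ax _ _ []. Qed.

Lemma linked_trans k A x y z : linked k A x y -> linked k A y z -> linked k A x z.
Proof.
by move=> H; elim: H z => // a b c Aa ab _ IH z /IH; apply: linked_step.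
Qed.

Lemma linked1 k A x y : A x -> A y -> mdist x y <= k -> linked k A x y.
Proof. by move=> Ax Ay xy; apply: linked_step xy _ => //; apply: linked_refl. Qed.

Lemma linked_sym k A x y : linked k A x y -> linked k A y x.
Proof.
elim=> [|a b c Aa ab bc IH]; first exact: linked_refl.
apply: linked_trans IH _; apply: linked1 => //; last by rewrite metric_sym.
by have [] := linked_in bc.
Qed.

Lemma linked_mono k A B x y : A `<=` B -> linked k A x y -> linked k B x y.
Proof.
move=> AB; elim=> [a /AB|a b c /AB Ba ab _]; first exact: linked_refl.
exact: linked_step.
Qed.

Lemma linked_exit k A (P : set X) x y : linked k A x y -> P x -> ~ P y ->
  exists u v, [/\ A u, A v, mdist u v <= k, linked k (A `&` P) x u & ~ P v].
Proof.
elim=> [//|a b c Aa ab bc IH] Pa nPc; have [Pb|nPb] := pselect (P b).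
  have [u [v [? ? ? bu ?]]] := IH Pb nPc; exists u, v; split=> //.
  exact: linked_step bu.
exists a, b; split=> //; first by have [] := linked_in bc.
exact: linked_refl.
Qed.

(** Consecutive points have product at least [D - k], and with hyperbolicity constant 0 nothing more
    is lost along the chain, however long it is. *)
Lemma linked_gp0 k A t D x y : 0 <= k -> gp_hyperbolic X 0 ->
  A `<=` [set q | D <= mdist t q] -> linked k A x y -> D - k <= gp t x y.
Proof.
move=> k0 hyp AD; elim=> [a /AD/= Da|a b c /AD/= Da ab bc IH].
  by rewrite gpxx; lra.
have := hyp t a b c; have := gpDl t a b; have := gp_le_distl a b t.
by rewrite (gpC a b t); move=> ? ? [|]; lra.
Qed.

End Linked.

Lemma linked_image (R : realType) (X Y : metricType R) (F : X -> Y) k k'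
    (A : set X) x y :
  (forall a b, mdist a b <= k -> mdist (F a) (F b) <= k') ->
  linked k A x y -> linked k' (F @` A) (F x) (F y).
Proof.
move=> Fk; elim=> [a Aa|a b c Aa ab _]; first by apply: linked_refl; exists a.
by apply: linked_step; [exists a|exact: Fk].
Qed.

(** * Rough geodesics and quasitrees *)

Definition rough_path (R : realType) (X : metricType R) (k L : R) (g : R -> X) :=
  forall s t, 0 <= s -> s <= t -> t <= L ->
    t - s - k <= mdist (g s) (g t) <= t - s + k.

(* Restated over a [realType] because [lra] does not see through the instance
   paths produced by the generic lemmas. *)
Lemma real_mulr_ge0 (R : realType) (a b : R) : 0 <= a -> 0 <= b -> 0 <= a * b.
Proof. exact: mulr_ge0. Qed.

Lemma real_ler_pM2l (R : realType) (a b c : R) : 0 < a -> b <= c -> a * b <= a * c.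
Proof. by move=> a0 bc; rewrite ler_pM2l. Qed.

Section RoughGeodesic.
Variables (R : realType) (X : metricType R) (k : R).

Lemma rough_geodesicP x y (S : set X) : rough_geodesic k x y S ->
  exists L g, [/\ 0 <= L, g 0 = x, g L = y, rough_path k L g &
    forall q, S q <-> exists2 t, 0 <= t <= L & q = g t].
Proof.
move=> [L [g [L0 g0 gL qi ->]]]; exists L, g; split=> //; last first.
  move=> q; split=> [[t /= tL <-]|[t tL ->]].
    by exists t => //; rewrite in_itv /= in tL.
  by exists t => //=; rewrite in_itv.
move=> s t s0 st tL.
have s0L : (`[0, L]%classic : set R^o) s by rewrite /= in_itv /=; lra.
have t0L : (`[0, L]%classic : set R^o) t by rewrite /= in_itv /=; lra.
have := qi s t s0L t0L.
have -> : mdist (s : R^o) t = t - s.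
  by have -> : mdist (s : R^o) t = `|t - s| by []; rewrite ger0_norm //; lra.
by rewrite invr1 !mul1r.
Qed.

Lemma rough_geodesic_gp x y (S : set X) q :
  rough_geodesic k x y S -> S q -> gp q x y <= 3 / 2 * k.
Proof.
move=> /rough_geodesicP[L [g [L0 <- <- gp_ SP]]] /SP[t /andP[t0 tL] ->].
have /andP[_ H1] := gp_ 0 t (lexx _) t0 tL.
have /andP[_ H2] := gp_ t L t0 tL (lexx _).
have /andP[H3 _] := gp_ 0 L (lexx _) L0 (lexx _).
by rewrite /gp (metric_sym (g t) (g 0)); lra.
Qed.

Lemma rough_geodesic_ends x y (S : set X) : rough_geodesic k x y S -> S x /\ S y.
Proof.
move=> /rough_geodesicP[L [g [L0 g0 gL _ SP]]]; split; apply/SP.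
  by exists 0; rewrite ?lexx.
by exists L; rewrite ?lexx ?L0.
Qed.

Lemma rough_path_linked L (g : R -> X) a b :
  rough_path k L g -> 0 <= a -> a <= b -> b <= L ->
  linked (1 + k) [set g t | t in [set t | a <= t <= b]] (g a) (g b).
Proof.
move=> gL a0 ab bL; have [n] : exists n : nat, b - a <= n%:R.
  by exists (Num.bound (b - a)); apply: ltW; apply: archi_boundP; lra.
elim: n a a0 ab => [|n IH] a a0 ab.
  move=> ba; have -> : a = b by lra.
  by apply: linked_refl; exists b => //=; lra.
have [ba1|ba1] := leP (b - a) 1 => ban.
  apply: linked1; [by exists a => //=; lra|by exists b => //=; lra|].
  by have := gL a b a0 ab bL; lra.
apply: (@linked_step _ _ _ _ _ (g (a + 1))); first by exists a => //=; lra.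
  by have := gL a (a + 1) a0; lra.
have := IH (a + 1); rewrite -natr1 in ban; move=> H.
apply: linked_mono (H _ _ _); [|lra|lra|lra].
by move=> _ [t /= tb <-]; exists t => //=; lra.
Qed.

Lemma rough_geodesic_linked x y (S : set X) :
  rough_geodesic k x y S -> linked (1 + k) S x y.
Proof.
move=> /rough_geodesicP[L [g [L0 g0 gL gp_ SP]]].
rewrite -g0 -gL; apply: linked_mono (rough_path_linked gp_ _ _ _) => //.
by move=> _ [t /= tL <-]; apply/SP; exists t.
Qed.

Lemma linked_mono_step k' (A : set X) x y :
  k <= k' -> linked k A x y -> linked k' A x y.
Proof.
move=> kk'; elim=> [a Aa|a b c Aa ab _]; first exact: linked_refl.
by apply: linked_step => //; lra.
Qed.

End RoughGeodesic.

(** * The bottleneck property of quasitrees *)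

Definition far (R : realType) (X : metricType R) (s : X) (r : R) : set X :=
  [set q | r <= mdist s q].

(** The middle clauses convert between chain components outside balls and Gromov products; the last
    one supplies the coarse midpoints that serve as separating points. *)
Definition treelike (R : realType) (Q : metricType R) (k K : R) :=
  [/\ gp_hyperbolic Q K,
      forall s u v r, r + K <= gp s u v -> linked k (far s r) u (v : Q),
      forall s u v r, linked k (far s r) u (v : Q) -> r - K <= gp s u v &
      forall u v : Q, exists s, [/\ gp s u v <= K,
        mdist u v / 2 - K <= mdist s u & mdist u v / 2 - K <= mdist s v]].

Lemma treelike_mono (R : realType) (Q : metricType R) (k K K' : R) :
  K <= K' -> treelike Q k K -> treelike Q k K'.
Proof.
move=> KK' [H1 H2 H3 H4]; split.
- by move=> w x y z; case: (H1 w x y z); [left|right]; lra.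
- by move=> s u v r Hr; apply: H2; lra.
- by move=> s u v r /H3; lra.
by move=> u v; have [s [? ? ?]] := H4 u v; exists s; split; lra.
Qed.

Lemma gp_hyperbolic0_branch (R : realType) (T : metricType R) (s u v a b : T) sg :
  gp_hyperbolic T 0 -> 0 <= sg ->
  mdist s a <= gp s u v -> gp s u v - sg <= gp s u a ->
  mdist s b <= gp s u v -> gp s u v - sg <= gp s v b -> mdist a b <= 2 * sg.
Proof.
move=> hypT sg0 sa ua sb vb; rewrite (dist_gp s).
have av : gp s u v - sg <= gp s a v.
  by have := hypT s a u v; rewrite (gpC s a u) => -[]; lra.
by have := hypT s a v b; move=> -[]; lra.
Qed.

Section Quasitree.
Variables (R : realType) (Q T : metricType R) (F : Q -> T) (k kp l c : R).
Hypotheses (hypT : gp_hyperbolic T 0) (k0 : 0 <= k) (kkp : 1 + k <= kp)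
  (l1 : 1 <= l) (c0 : 0 <= c)
  (F_low : forall x y, l^-1 * mdist x y - c <= mdist (F x) (F y))
  (F_up : forall x y, mdist (F x) (F y) <= l * mdist x y + c)
  (Qgeod : roughly_geodesic_with k Q).

(** [sg] bounds the steps of the image of a [kp]-chain under [F], [K1] is the Morse constant, and
    [rho0] comes from pulling [K1] back through [F]. *)
Let sg := l * kp + c.
Let K1 := sg + l * (l * (2 * sg + c) + 2 * k) + c.
Let rho0 := l * (K1 + c + sg).

(* [lra] ignores section hypotheses. *)
Ltac consts := have := c0; have := k0; have := kkp; have := l1; move=> ? ? ? ?.

Let l0 : 0 < l. Proof. by apply: lt_le_trans l1; exact: ltr01. Qed.
Let linv0 : 0 < l^-1. Proof. by rewrite invr_gt0. Qed.
Let sg0 : 0 <= sg.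
Proof.
consts; have := real_mulr_ge0 (ltW l0) (le_trans (addr_ge0 ler01 k0) kkp).
by rewrite /sg; lra.
Qed.
Let K10 : 0 <= K1.
Proof.
consts; have ? := sg0; have : 0 <= l * (l * (2 * sg + c) + 2 * k).
  apply: mulr_ge0; [exact: ltW|apply: addr_ge0; last lra].
  by apply: mulr_ge0; [exact: ltW|lra].
by rewrite /K1; lra.
Qed.
Let rho00 : 0 <= rho0.
Proof. by consts; have ? := sg0; have ? := K10; apply: mulr_ge0; [exact: ltW|lra]. Qed.

Let F_low' x y : mdist x y <= l * (mdist (F x) (F y) + c).
Proof.
have := F_low x y; rewrite lerBlDr => H.
have := real_ler_pM2l l0 H.
by rewrite mulrA divff ?mul1r // gt_eqF.
Qed.

Lemma linked_Fimage A u v : linked kp A u v -> linked sg (F @` A) (F u) (F v).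
Proof.
consts; apply: linked_image => a b ab; have := F_up a b.
by have := real_ler_pM2l l0 ab; rewrite /sg; lra.
Qed.

(** The point sought is the first of the chain whose image enters the ball of radius [g] about
    [F s]; up to there the image stays on the side of [F u]. *)
Lemma morse_side A u s g : linked kp A u s -> 0 < g -> g <= mdist (F s) (F u) ->
  exists w, [/\ A w, mdist (F s) (F w) <= g & g - sg <= gp (F s) (F u) (F w)].
Proof.
consts; move=> us g0 gu.
pose P := [set q | g <= mdist (F s) (F q)].
have [|w [w' [Aw Aw' ww' uw nPw']]] := linked_exit us (P := P) gu.
  by rewrite /P /= mdistxx; lra.
exists w'; split=> //; first by move: nPw'; rewrite /P /=; move=> /negP; lra.
have uwF : g - sg <= gp (F s) (F u) (F w).
  apply: (linked_gp0 sg0 hypT _ (linked_Fimage uw)).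
  by move=> _ [q [_ Pq] <-].
have Pw : g <= mdist (F s) (F w) by have [_ [_]] := linked_in uw.
have ww : mdist (F w) (F w') <= sg.
  have := F_up w w'; have := real_ler_pM2l l0 ww'; rewrite /sg; lra.
have := gpDl (F s) (F w) (F w'); have := gp_le_distl (F w) (F w') (F s).
rewrite (gpC (F w)); have := hypT (F s) (F u) (F w) (F w').
by move=> [|]; lra.
Qed.

(** Before and after time [t] the image passes near the point where the directions from [F (g t)] to
    the two ends branch. The two times are then close to each other, so [F (g t)] is itself near
    that branch point, which bounds the product. *)
Lemma morse L g t : rough_path k L g -> 0 <= t -> t <= L ->
  gp (F (g t)) (F (g 0)) (F (g L)) <= K1.
Proof.
consts; have ? := sg0; have ? := K10; move=> gL t0 tL.
have [|G0] := leP (gp (F (g t)) (F (g 0)) (F (g L))) 0.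
  by move=> /le_trans; apply.
have [w [[t1 /= t1P <-] w1 w2]] := morse_side
  (linked_mono_step kkp (rough_path_linked gL (lexx 0) t0 tL)) G0 (gp_le_distl _ _ _).
have [w' [[t2 /= t2P <-] w3 w4]] := morse_side
  (linked_sym (linked_mono_step kkp (rough_path_linked gL t0 tL (lexx L)))) G0
  (gp_le_distr _ _ _).
have H3 := gp_hyperbolic0_branch hypT sg0 w1 w2 w3 w4.
have H4 : mdist (g t1) (g t2) <= l * (2 * sg + c).
  by apply: le_trans (F_low' _ _) _; apply: ler_wpM2l; lra.
have H5 : mdist (g t1) (g t) <= l * (2 * sg + c) + 2 * k.
  have := gL t1 t2; have := gL t1 t; lra.
have H6 := real_ler_pM2l l0 H5.
have := F_up (g t1) (g t); have := gp_le_distr (F (g t)) (F (g 0)) (F (g t1)).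
rewrite (metric_sym _ (F (g t))) /K1; lra.
Qed.

(** A chain around a ball about [g t] maps to a chain around a ball about [F (g t)], which forces a
    large Gromov product there, against [morse]. *)
Lemma bottleneck L (g : R -> Q) t D : rough_path k L g -> 0 <= t -> t <= L ->
  linked kp (far (g t) D) (g 0) (g L) -> D <= rho0.
Proof.
consts; move=> gL t0 tL /linked_Fimage H.
have H1 : (l^-1 * D - c) - sg <= gp (F (g t)) (F (g 0)) (F (g L)).
  apply: linked_gp0 sg0 hypT _ H => _ [q Dq <-] /=.
  have := F_low (g t) q; have := real_ler_pM2l linv0 Dq.
  by lra.
have := morse gL t0 tL => H2.
have H3 : l^-1 * D <= K1 + c + sg by lra.
have := real_ler_pM2l l0 H3; by rewrite mulrA divff ?mul1r // gt_eqF.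
Qed.

Lemma bottleneck_geodesic (u v : Q) (S : set Q) q D : rough_geodesic k u v S -> S q ->
  linked kp (far q D) u v -> D <= rho0.
Proof.
move=> /rough_geodesicP[L [g [L0 <- <- gL SP]]] /SP[t /andP[t0 tL] ->].
exact: bottleneck gL t0 tL.
Qed.

Let rho := 3 * rho0 + 2 + kp + 3 * k.

Lemma bottleneck_center (s u v : Q) : exists S q, [/\ rough_geodesic k u v S, S q &
  mdist s q <= gp s u v + 2 * rho0 + 2 + kp + 3 * k].
Proof.
consts; have ? := rho00.
have [Suv uvS] := Qgeod u v; have [Sus usS] := Qgeod u s; have [Ssv svS] := Qgeod s v.
(* Otherwise [Sus] and [Ssv] together form a chain from [u] to [v] around [t]. *)
have near t : Suv t -> (exists2 q, Sus q & mdist t q < rho0 + 1) \/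
    (exists2 q, Ssv q & mdist t q < rho0 + 1).
  move=> tS; apply: contrapT => /not_orP[nus nsv].
  have : linked kp (far t (rho0 + 1)) u v.
    apply: (@linked_trans _ _ _ _ _ s).
      apply: linked_mono (linked_mono_step kkp (rough_geodesic_linked usS)) => q qS.
      by rewrite /far /= leNgt; apply/negP => tq; apply: nus; exists q.
    apply: linked_mono (linked_mono_step kkp (rough_geodesic_linked svS)) => q qS.
    by rewrite /far /= leNgt; apply/negP => tq; apply: nsv; exists q.
  by move=> /(bottleneck_geodesic uvS tS); lra.
have [uS vS] := rough_geodesic_ends uvS.
(* Either [v] is near [Sus], or a chain along [Suv] leaves the neighbourhood of [Sus] and the last
   point before it does so is near both sides. *)
have [t [tS [q1 q1S tq1] [q2 q2S tq2]]] : exists t, [/\ Suv t,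
    exists2 q, Sus q & mdist t q < rho0 + 1 &
    exists2 q, Ssv q & mdist t q < rho0 + 1 + kp].
  have [[q qS vq]|Nv] := pselect (exists2 q, Sus q & mdist v q < rho0 + 1).
    exists v; split; [by []|by exists q|].
    exists v; first by have [] := rough_geodesic_ends svS.
    by rewrite mdistxx; lra.
  have [|w [w' [wS w'S ww' uw nw']]] := linked_exit
     (P := [set t | exists2 q, Sus q & mdist t q < rho0 + 1])
     (linked_mono_step kkp (rough_geodesic_linked uvS)) _ Nv.
    exists u; first by have [] := rough_geodesic_ends usS.
    by rewrite mdistxx; lra.
  exists w; split=> //; first by have [_ []] := linked_in uw.
  have [//|[q qS w'q]] := near w' w'S; exists q => //.
  by have := metric_triangle w w' q; lra.
exists Suv, t; split=> //.
have := gp_base t q1 u s; have := rough_geodesic_gp usS q1S.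
have := gp_base t q2 s v; have := rough_geodesic_gp svS q2S.
have := metric_triangle u t v.
rewrite /gp (metric_sym u t) (metric_sym t s) (metric_sym s u).
by lra.
Qed.

(** The bottleneck property is applied at a point [q] of a geodesic near [s], with the radius
    reduced by [mdist s q]. *)
Lemma linked_far_gp (s u v : Q) D : linked kp (far s D) u v -> D - rho <= gp s u v.
Proof.
consts; move=> Duv; have [S [q [uvS qS sq]]] := bottleneck_center s u v.
have : linked kp (far q (D - mdist s q)) u v.
  apply: linked_mono Duv => p; rewrite /far /=.
  by have := metric_triangle s q p; lra.
by move=> /(bottleneck_geodesic uvS qS); rewrite /rho; lra.
Qed.

Lemma gp_linked_far (s u v : Q) D : D + 3 / 2 * k <= gp s u v -> linked kp (far s D) u v.
Proof.
move=> H; have [S uvS] := Qgeod u v.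
apply: linked_mono (linked_mono_step kkp (rough_geodesic_linked uvS)) => q qS.
have := rough_geodesic_gp uvS qS; have := gp_base s q u v; rewrite /far /=; lra.
Qed.

Lemma quasitree_treelike_aux : treelike Q kp (rho + 3 * k).
Proof.
consts; have ? := rho00; have ? : 0 <= rho by rewrite /rho; lra.
split.
- move=> w x y z.
  (* Hyperbolicity comes from the transitivity of chains outside a ball about [w]. *)
  have H D : D + 3 / 2 * k <= gp w x y -> D + 3 / 2 * k <= gp w y z ->
      D - rho <= gp w x z.
    move=> /gp_linked_far xy /gp_linked_far yz.
    by apply: linked_far_gp; apply: linked_trans xy yz.
  have [xyz|xyz] := leP (gp w x y) (gp w y z); [left|right].
    by have := H (gp w x y - 3 / 2 * k); lra.
  by have := H (gp w y z - 3 / 2 * k); lra.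
- by move=> s u v r H; apply: gp_linked_far; lra.
- by move=> s u v r /linked_far_gp; lra.
move=> u v; have [S] := Qgeod u v.
move=> /rough_geodesicP[L [g [L0 <- <- gL _]]].
have := gL 0 (L / 2); have := gL (L / 2) L; have := gL 0 L.
move=> H1 H2 H3; exists (g (L / 2)); rewrite /gp (metric_sym _ (g 0)).
by split; lra.
Qed.

End Quasitree.

Lemma quasitree_treelike (R : realType) (Q : metricType R) :
  quasitree Q -> roughly_geodesic Q ->
  exists kp K, 0 <= K /\ treelike Q kp K.
Proof.
move=> [T [e [e_sym _ e_path e_dist]] [F [l [c [l1 c0 FQI]]] _]] [k Qk].
have hypT := tree_gp_hyperbolic e_sym e_path e_dist.
(* The absolute value gives a sign condition that an empty [Q] would not force on [k]. *)
have Qk' : roughly_geodesic_with `|k| Q.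
  move=> x y; have [S [L [g [L0 g0 gL qi SE]]]] := Qk x y.
  exists S, L, g; split=> //.
  by move=> s t s0 tL; have := qi s t s0 tL; have := ler_norm k; lra.
have F1 x y : l^-1 * mdist x y - c <= mdist (F x) (F y).
  by have /andP[] := FQI x y I I.
have F2 x y : mdist (F x) (F y) <= l * mdist x y + c.
  by have /andP[] := FQI x y I I.
have H := quasitree_treelike_aux hypT (normr_ge0 k) (lexx _) l1 c0 F1 F2 Qk'.
set K := (X in treelike _ _ X) in H.
exists (1 + `|k|), `|K|; split=> //.
by apply: treelike_mono H; apply: ler_norm.
Qed.

(** * Hyperbolic spaces and isometries of products *)

Section Hyperbolic.
Variables (R : realType) (X : metricType R).

Lemma rough_geodesic_ge0 k (x y : X) S : rough_geodesic k x y S -> 0 <= k.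
Proof.
move=> /rough_geodesicP[L [g [L0 _ _ gL _]]].
by have := gL 0 0 (lexx _) (lexx _) L0; rewrite mdistxx; lra.
Qed.

Lemma rough_geodesic_center k d (x y p : X) S : 0 <= d -> gp_hyperbolic X d ->
  rough_geodesic k x y S ->
  exists q, [/\ S q, gp q x y <= 5 * k + 2 * d, gp q x p <= 5 * k + 2 * d &
    gp q y p <= 5 * k + 2 * d].
Proof.
move=> d0 hyp xyS; have k0 := rough_geodesic_ge0 xyS.
move: xyS => /rough_geodesicP[L [g [L0 <- <- gL SP]]].
set x' := g 0; set y' := g L; set t := gp x' y' p.
have t0 : 0 <= t by apply: gp_ge0.
have tL : t <= L + k.
  by have := gp_le_distl x' y' p; have := gL 0 L; rewrite -/t -/x' -/y'; lra.
(* The centre is approximated by the point at parameter [t], truncated because [t] may exceed [L] by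
   up to [k]. *)
have [t' [t'0 t'L t't tt']] : exists t', [/\ 0 <= t', t' <= L, t' <= t & t <= t' + k].
  by have [tl|tl] := leP t L; [exists t|exists L]; split; lra.
have xq := gL 0 t' (lexx 0) t'0 t'L; have qy := gL t' L t'0 t'L (lexx L).
have xy := gL 0 L (lexx 0) L0 (lexx L).
move: xq qy xy; rewrite -/x' -/y'; set q := g t' => xq qy xy.
have qxy : gp q x' y' <= 2 * k.
  have : mdist q y' <= mdist x' y' - t + 3 * k by lra.
  by rewrite /gp (metric_sym q x'); lra.
have tE : t + gp p x' y' = mdist x' p.
  by rewrite /t /gp (metric_sym p x') (metric_sym p y'); lra.
have tE' : mdist x' y' - t + gp p x' y' = mdist y' p.
  by rewrite /t /gp (metric_sym p x') (metric_sym p y'); lra.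
exists q; split=> //; [by apply/SP; exists t' => //; lra|lra| |].
  have := hyp q x' p y'; move: tE tE' qxy.
  by rewrite /gp (metric_sym q x') (metric_sym p x') (metric_sym p y') => ? ? ? []; lra.
have := hyp q x' p y'; move: tE tE' qxy.
by rewrite /gp (metric_sym q x') (metric_sym p x') (metric_sym p y') => ? ? ? []; lra.
Qed.

(** Otherwise the four-point condition puts [u] and [v] in the reverse order, and comparing their
    distances from [x] makes them close to each other. *)
Lemma gp_ordered d A B (x y u v : X) : 0 <= d -> gp_hyperbolic X d -> 0 <= A ->
  0 <= B -> gp u x y <= A -> gp v x y <= A -> mdist x u <= mdist x v + B ->
  gp u x v <= 4 * A + 2 * d + B /\ gp v u y <= 4 * A + 2 * d + B.
Proof.
move=> d0 hyp A0 B0 uA vA uv; split.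
  have [|H] := hyp u x v y; first lra.
  have H2 := gp_le_distr u x v.
  have := metric_triangle x u y; move: H H2 uA vA.
  by rewrite /gp (metric_sym u x) (metric_sym v x); lra.
have [H|H] := hyp v x u y; last lra.
have H2 := gp_le_distl v u y.
by move: H H2 vA; rewrite /gp (metric_sym v x) (metric_sym v u); lra.
Qed.

End Hyperbolic.

Section Between.
Variables (R : realType) (X Y : metricType R).

(* Coarse betweenness is the only consequence of being quasimedian that is used. *)
Lemma quasimedian_between kX kY l c d (muX : X -> X -> X -> X)
    (muY : Y -> Y -> Y -> Y) (f : X -> Y) :
  roughly_geodesic_with kX X -> roughly_geodesic_with kY Y ->
  coarse_median muX -> coarse_median muY -> 0 <= l ->
  (forall x y, mdist (f x) (f y) <= l * mdist x y + c) ->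
  (forall x y z, mdist (muY (f x) (f y) (f z)) (f (muX x y z)) <= d) ->
  forall E, exists E', forall q x y, gp q x y <= E -> gp (f q) (f x) (f y) <= E'.
Proof.
move=> Xg Yg mX mY l0 lip qm E.
have [DX HX] := mX kX; have [DY HY] := mY kY.
exists (DY + 3 / 2 * kY + d + (l * (E + 2 * (DX + 3 / 2 * kX)) + c)) => q x y qE.
have near (Z : metricType R) k (D : R) (a b w : Z) S :
    rough_geodesic k a b S -> mnbhd D S w -> gp w a b <= D + 3 / 2 * k.
  move=> abS [p pS wp]; have := rough_geodesic_gp abS pS.
  by have := gp_base w p a b; lra.
have [S1 S1g] := Xg x q; have [S2 S2g] := Xg q y; have [S3 S3g] := Xg x y.
have [/(near _ _ _ _ _ _ _ S1g) m1 /(near _ _ _ _ _ _ _ S2g) m2 _] :=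
  HX _ _ _ _ _ _ S1g S2g S3g.
have [T1 T1g] := Yg (f x) (f q); have [T2 T2g] := Yg (f q) (f y).
have [T3 T3g] := Yg (f x) (f y).
have [_ _ /(near _ _ _ _ _ _ _ T3g) m3] := HY _ _ _ _ _ _ T1g T2g T3g.
set m := muX x q y in m1 m2; set n := muY _ _ _ in m3.
(* Adding the estimates for the sides [xq] and [qy], the lengths [xm] and [my] cancel against
   [xy]. *)
have mq : mdist m q <= E + 2 * (DX + 3 / 2 * kX).
  move: m1 m2 qE; rewrite /gp (metric_sym q x).
  by have := metric_triangle x m y; rewrite (metric_sym x m); lra.
have lmq : l * mdist m q <= l * (E + 2 * (DX + 3 / 2 * kX)).
  by apply: ler_wpM2l.
have := lip m q; have := qm x q y; rewrite -/m -/n => nm fmq.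
have := gp_base (f q) n (f x) (f y); have := metric_triangle n (f m) (f q).
by rewrite (metric_sym n (f q)); lra.
Qed.

End Between.

Section ProductIsometry.
Variables (R : realType) (m : nat) (Q : 'I_m -> metricType R).
Notation P := (l1_prod Q).
Implicit Types (u v w : P) (i j : 'I_m).

Lemma l1_distE u v : mdist u v = \sum_(i < m) mdist (u i) (v i).
Proof. by []. Qed.

Lemma l1_dist_coord i u v : mdist (u i) (v i) <= mdist u v.
Proof.
rewrite l1_distE (bigD1 i) //= lerDl; apply: sumr_ge0 => j _; exact: mdist_ge0.
Qed.

Lemma l1_dist_one i u v : (forall j, j != i -> u j = v j) ->
  mdist u v = mdist (u i) (v i).
Proof.
move=> uv; rewrite l1_distE (bigD1 i) //= big1 ?addr0 // => j /uv ->.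
exact: mdistxx.
Qed.

Lemma l1_between u v w : (forall i, mdist (u i) (v i) + mdist (v i) (w i) =
    mdist (u i) (w i)) <-> mdist u v + mdist v w = mdist u w.
Proof.
rewrite !l1_distE -big_split /=; split=> [H|/eqP]; first exact: eq_bigr.
rewrite -subr_eq0 -sumrB psumr_eq0 => [/allP H i|i _].
  by apply/eqP; rewrite -subr_eq0; apply: H; apply: mem_index_enum.
by rewrite subr_ge0 metric_triangle.
Qed.

Definition isometry (h : P -> P) := forall u v, mdist (h u) (h v) = mdist u v.

Variable K : R.
Hypothesis Q_hyp : forall i, gp_hyperbolic (Q i) K.

(* Each corner of the square is metrically between its neighbours; this is
   inherited by each coordinate of the image, where opposite sides then have
   equal length and the four-point condition makes one pair of sides short. *)
Lemma isometry_square h i k u c v c' : isometry h ->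
  c i = v i -> c' i = u i -> (forall j, j != i -> c j = u j) ->
  (forall j, j != i -> c' j = v j) ->
  let a := mdist (h u k) (h c k) in let b := mdist (h u k) (h c' k) in
  [/\ mdist (h v k) (h c' k) = a, mdist (h v k) (h c k) = b & a <= K \/ b <= K].
Proof.
move=> hi ci c'i cj c'j a b.
have btw (p q r : P) :
    (forall j, mdist (p j) (q j) + mdist (q j) (r j) = mdist (p j) (r j)) ->
    mdist (h p k) (h q k) + mdist (h q k) (h r k) = mdist (h p k) (h r k).
  move=> /(l1_between p q r).1 H.
  by apply: ((l1_between (h p) (h q) (h r)).2 _ k); rewrite !hi.
have H1 : mdist (h u k) (h c k) + mdist (h c k) (h v k) = mdist (h u k) (h v k).
  apply: btw => j; have [->|/cj ->] := eqVneq j i; last by rewrite mdistxx add0r.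
  by rewrite ci mdistxx addr0.
have H2 : mdist (h u k) (h c' k) + mdist (h c' k) (h v k) = mdist (h u k) (h v k).
  apply: btw => j; have [->|/c'j ->] := eqVneq j i; last by rewrite mdistxx addr0.
  by rewrite c'i mdistxx add0r.
have H3 : mdist (h c k) (h u k) + mdist (h u k) (h c' k) = mdist (h c k) (h c' k).
  apply: btw => j; have [->|ji] := eqVneq j i; first by rewrite c'i mdistxx addr0.
  by rewrite cj // mdistxx add0r.
have H4 : mdist (h c k) (h v k) + mdist (h v k) (h c' k) = mdist (h c k) (h c' k).
  apply: btw => j; have [->|ji] := eqVneq j i; first by rewrite ci mdistxx add0r.
  by rewrite c'j // mdistxx addr0.
have := Q_hyp (h u k) (h c k) (h v k) (h c' k).
move: H1 H2 H3 H4; rewrite /a /b /gp (metric_sym (h c k) (h u k)).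
rewrite (metric_sym (h c' k) (h v k)) (metric_sym (h c k) (h v k)).
move=> H1 H2 H3 H4 H5; split; [lra|lra|].
by case: H5 => ?; [left|right]; lra.
Qed.

(** Parallel edges in direction [i] have images of equal length in coordinate [k], so at every [v]
    some move in direction [i] has a long image. In the square spanned by it and the change from [v]
    to [w], the latter side must be short. *)
Lemma isometry_one_coord h i k u u' : isometry h ->
  (forall j, j != i -> u' j = u j) -> 2 * K < mdist (h u k) (h u' k) ->
  forall v w, v i = w i -> mdist (h v k) (h w k) <= K.
Proof.
move=> hi uu' big v w vw.
have step (a : Q i) : K < mdist (h v k) (h (dfwith v i a) k) ->
    mdist (h v k) (h w k) <= K.
  move=> Ka; have [||||_ _ []] :=
    @isometry_square h i k v (dfwith v i a) (dfwith w i a) w hi.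
  - by rewrite !dfwithin.
  - by [].
  - by move=> j ji; rewrite dfwithout // eq_sym.
  - by move=> j ji; rewrite dfwithout // eq_sym.
  - by move=> ?; lra.
  by [].
have [||||E _ _] := @isometry_square h i k u u'
  (dfwith v i (u' i)) (dfwith v i (u i)) hi.
- by rewrite dfwithin.
- by rewrite dfwithin.
- by [].
- by move=> j ji; rewrite !dfwithout // eq_sym.
have [|s1] := ltP K (mdist (h v k) (h (dfwith v i (u i)) k)); first exact: step.
have [|s2] := ltP K (mdist (h v k) (h (dfwith v i (u' i)) k)); first exact: step.
have := metric_triangle (h (dfwith v i (u' i)) k) (h v k) (h (dfwith v i (u i)) k).
by rewrite E (metric_sym _ (h v k)); lra.
Qed.

Lemma isometry_one_coord_le h i k : isometry h ->
  (forall v w, v i = w i -> mdist (h v k) (h w k) <= K) ->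
  forall v w, mdist (h v k) (h w k) <= mdist (v i) (w i) + K.
Proof.
move=> hi H v w; pose z : P := dfwith v i (w i).
have vz : mdist (h v k) (h z k) <= mdist (v i) (w i).
  apply: le_trans (l1_dist_coord k (h v) (h z)) _.
  rewrite hi (@l1_dist_one i) /z ?dfwithin // => j ji.
  by rewrite dfwithout // eq_sym.
have := H z w; rewrite {1}/z dfwithin => /(_ erefl).
by have := metric_triangle (h v k) (h z k) (h w k); lra.
Qed.

Lemma isometry_permutes_coord h h' i w w' : isometry h -> cancel h' h -> cancel h h' ->
  m%:R * (3 * K) < mdist (w i) (w' i) ->
  exists j, forall u v, mdist (h u i) (h v i) <= mdist (u j) (v j) + K /\
                        mdist (u j) (v j) <= mdist (h u i) (h v i) + K.
Proof.
move=> hi h'K hK ww'.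
have h'i : isometry h' by move=> u v; rewrite -hi !h'K.
pose w1 : P := dfwith w i (w' i).
have w1E j : j != i -> w1 j = w j by move=> ji; rewrite /w1 dfwithout // eq_sym.
(* The move of coordinate [i] has its full length spread by [h'] over [m] coordinates, so one of
   them gets more than [3 * K]. *)
have [j hj] : exists j, 3 * K < mdist (h' w j) (h' w1 j).
  apply: contrapT => /forallNP H.
  have : mdist (h' w) (h' w1) <= m%:R * (3 * K).
    rewrite l1_distE; apply: le_trans (_ : \sum_(j < m) 3 * K <= _).
      by apply: ler_sum => j _; rewrite leNgt; apply/negP => /(H j).
    by rewrite sumr_const card_ord [leRHS]mulr_natl.
  rewrite h'i (@l1_dist_one i); last by move=> ? /w1E.
  by rewrite /w1 dfwithin; lra.
have K0 : 0 <= K by have := Q_hyp (w i) (w i) (w i) (w i); rewrite gp_same; case; lra.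
have H1 := isometry_one_coord h'i w1E (_ : 2 * K < mdist (h' w j) (h' w1 j)).
have {}H1 := isometry_one_coord_le h'i (H1 ltac:(lra)).
have {}H1 u v : mdist (u j) (v j) <= mdist (h u i) (h v i) + K.
  by have := H1 (h u) (h v); rewrite !hK.
(* The bound [H1] for [h'] turns a change of coordinate [j] by more than [3 * K] into one of
   coordinate [i] under [h] by more than [2 * K], so that [isometry_one_coord] applies to [h] as
   well. *)
pose u := h' w; pose u1 : P := dfwith u j (h' w1 j).
have u1E k : k != j -> u1 k = u k by move=> kj; rewrite /u1 dfwithout // eq_sym.
have big : 2 * K < mdist (h u i) (h u1 i).
  by have := H1 u u1; rewrite {1}/u1 dfwithin; lra.
exists j => a b; split=> //.
exact: isometry_one_coord_le hi (isometry_one_coord hi u1E big) a b.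
Qed.

End ProductIsometry.

(** * Separation in a quasitree *)

Section Separation.
Variables (R : realType) (Q : metricType R) (K : R).
Hypothesis hyp : gp_hyperbolic Q K.
Implicit Types (a b e s w z : Q).

(** If [z] is between [a] and [b], then from [s] it lies on the way to one of them: the four-point
    condition at [z] bounds [gp z a s] or [gp z s b]. *)
Lemma gp_branch E s z a b : gp z a b <= E ->
  mdist s z - E - K <= gp s a z \/ mdist s z - E - K <= gp s b z.
Proof.
move=> zab; have := hyp z a s b; have := gpDl s z a; have := gpDl s z b.
by rewrite !(gpC s z) (gpC z a s) => ? ? [|]; [left|right]; lra.
Qed.

(** A large product at [s] means lying on the same side of [s]; this is coarse transitivity in
    contrapositive form. *)
Lemma gp_transfer A s a b c : gp s a b <= A -> A + K < gp s b c -> gp s a c <= A + K.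
Proof. by move=> ab bc; have := hyp s a c b; rewrite (gpC s c b) => -[]; lra. Qed.

Lemma gp_branch_other E A s z a b : gp z a b <= E -> gp s b z <= A ->
  A < mdist s z - E - K -> mdist s z - E - K <= gp s a z.
Proof. by move=> zab bz Ad; have := gp_branch s zab => -[]; lra. Qed.

(** [z] is far from [s], being between [a] and [a'], hence on the side of [a] or of [b]. In either
    case it is also between two points deep on the other side. *)
Lemma separation_contra A B E s z a b a' b' :
  gp z a b <= E -> gp z a a' <= E -> gp z b b' <= E ->
  gp s a b <= A -> B <= gp s a a' -> B <= gp s b b' ->
  A + 2 * E + 3 * K < B -> 0 <= E -> 0 <= K -> False.
Proof.
have case1 a1 b1 b1' : gp z b1 b1' <= E -> gp s a1 b1 <= A -> B <= gp s b1 b1' ->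
    A + 2 * E + 3 * K < B -> 0 <= E -> 0 <= K -> B - E <= mdist s z ->
    mdist s z - E - K <= gp s a1 z -> False.
  move=> zbb sab sbb AB E0 K0 dB saz.
  have sbz : gp s b1 z <= A + K.
    by apply: (@gp_transfer A s b1 a1 z); [rewrite gpC|lra].
  have sbz' : gp s z b1' <= A + K + K.
    by apply: (@gp_transfer (A + K) s z b1 b1'); [rewrite gpC|lra].
  by have := gp_branch s zbb; rewrite (gpC s b1') => -[]; lra.
move=> zab zaa zbb sab saa sbb AB E0 K0.
have dB : B - E <= mdist s z by have := gp_base s z a a'; lra.
have [H|H] := gp_branch s zab; first exact: case1 zbb sab sbb AB E0 K0 dB H.
by apply: (@case1 b a a'); rewrite // gpC.
Qed.

(* [w1] and [w2] are the projections to the side [ab] of the points [b1] and [b2]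
   separated by [s]; as [s] also separates [b] from [e], the point [w2] is stuck
   near the centre [z] of the triangle [abe], while [w1] is far from it. *)
Lemma separation_at_branch A B C E s z w1 w2 a b e b1 b2 :
  gp w1 a b <= E -> gp w1 a b1 <= E -> gp w1 b b1 <= E ->
  gp w2 a b <= E -> gp w2 a b2 <= E -> gp w2 b b2 <= E ->
  gp w2 a z <= E -> gp z a b <= E -> gp z a e <= E ->
  gp s a b <= A -> B <= gp s a b1 -> B <= gp s b b2 -> gp s b e <= C ->
  A + 10 * E + 10 * K < B -> 0 <= E -> 0 <= K ->
  mdist w2 z <= C - B + 5 * E + 5 * K /\
  2 * B - 2 * A - 5 * E - 9 * K <= mdist w1 z.
Proof.
have side w a1 b1' a1' : gp w a1 b1' <= E -> gp w a1 a1' <= E -> gp w b1' a1' <= E ->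
    gp s a1 b1' <= A -> B <= gp s a1 a1' -> A + 10 * E + 10 * K < B ->
    0 <= E -> 0 <= K -> B - 2 * E - K <= gp s a1 w.
  move=> wab waa wba sab saa AB E0 K0.
  have dB : B - E <= mdist s w by have := gp_base s w a1 a1'; lra.
  have sba : gp s b1' a1' <= A + K by apply: (gp_transfer (b := a1)); [rewrite gpC|lra].
  have [|H] := gp_branch s wab; first lra.
  have := gp_branch s waa => -[|H2]; first lra.
  have := hyp s b1' w a1'; rewrite (gpC s w a1') => -[]; lra.
move=> w1ab w1a1 w1b1 w2ab w2a2 w2b2 w2az zab zae sab sa1 sb2 sbe AB E0 K0.
have saw1 := side _ _ _ _ w1ab w1a1 w1b1 sab sa1 AB E0 K0.
have sbw2 : B - 2 * E - K <= gp s b w2.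
  by apply: (@side w2 b a b2); rewrite // gpC.
have saw2 : gp s a w2 <= A + K by apply: (gp_transfer (b := b)); lra.
have dw2 := gp_le_distr s b w2.
have sw2z : mdist s w2 - E - K <= gp s w2 z.
  by have := gp_branch s w2az => -[|]; rewrite ?(gpC s z); lra.
have w2sz : gp w2 s z <= E + K by have := gpDl s w2 z; lra.
have saz : gp s a z <= A + K + K by apply: (gp_transfer (b := w2)); lra.
have dz := gp_le_distr s w2 z.
have sbz : mdist s z - E - K <= gp s b z.
  by apply: (gp_branch_other (A := A + K + K) (b := a)); rewrite ?(gpC z b) //; lra.
have sez : mdist s z - E - K <= gp s e z.
  by apply: (gp_branch_other (A := A + K + K) (b := a)); rewrite ?(gpC z e) //; lra.
(* From [s], both [b] and [e] lie in the direction of [z], so the bound on [gp s b e] limits the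
   depth of [z]. *)
have dsz : mdist s z <= C + E + 2 * K.
  by have := hyp s b z e; rewrite (gpC s z e) => -[]; lra.
have sw1z : gp s w1 z <= A + K + K + K.
  by rewrite gpC; apply: (gp_transfer (b := a)); [rewrite gpC|lra].
have dw1 := gp_le_distr s a w1.
split; last by rewrite (dist_gp s); lra.
by move: w2sz; rewrite /gp (metric_sym w2 s); lra.
Qed.

(** [s] is a coarse midpoint of [b1] and [b2]; the size of [mdist b1 b2] puts both deep on opposite
    sides, and [a], [b] lie behind them. *)
Lemma separation_exists kp r r' E a b b1 b2 : treelike Q kp K ->
  gp b1 a b2 <= E -> gp b2 b b1 <= E -> 0 <= E -> 0 <= K -> 4 * K < r' -> r' <= r ->
  2 * r + 2 * E + 10 * K < mdist b1 b2 ->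
  exists s, [/\ linked kp (far s r) a b1, linked kp (far s r) b b2 &
    ~ linked kp (far s r') a b].
Proof.
move=> [_ F1 F2 F3] b1E b2E E0 K0 r'K r'r big.
have [s [s12 d1 d2]] := F3 b1 b2; exists s.
have side c c' a' : gp c a' c' <= E -> gp s c c' <= K ->
    mdist b1 b2 / 2 - K <= mdist s c -> r + K <= gp s a' c.
  move=> cE sc dc; have [|] := gp_branch s cE; rewrite ?(gpC s c'); lra.
have sa1 := side _ _ _ b1E s12 d1.
have sb2 : r + K <= gp s b b2 by apply: (side b2 b1 b) => //; rewrite gpC.
split; [exact: F1|exact: F1|move=> /F2 sab].
have s1b : gp s b1 b <= K + K by apply: (gp_transfer (b := b2)); rewrite ?(gpC s b2); lra.
have sba : gp s b a <= K + K + K.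
  by apply: (gp_transfer (b := b1)); rewrite ?(gpC s b b1) ?(gpC s b1 a); lra.
by rewrite gpC in sba; lra.
Qed.

End Separation.

(** * Cylinders *)

Definition witness (R : realType) (X Q : metricType R) (phi : X -> Q)
    (kp L r r' : R) (x y p : X) : Prop :=
  exists s p1 p2, [/\ mdist p p1 <= L, mdist p p2 <= L,
    linked kp (far s r) (phi x) (phi p1), linked kp (far s r) (phi y) (phi p2) &
    ~ linked kp (far s r') (phi x) (phi y)].

Lemma witness_sym (R : realType) (X Q : metricType R) (phi : X -> Q) kp L r r' x y p :
  witness phi kp L r r' x y p -> witness phi kp L r r' y x p.
Proof.
move=> [s [p1 [p2 [pp1 pp2 xp1 yp2 xy]]]]; exists s, p2, p1; split=> //.
by move=> /linked_sym.
Qed.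

(* The witnesses [s], [p1], [p2] for [x] and [y] remain witnesses for [x] and [z]
   unless [s] separates [y] from [z]. *)
Lemma witness_change (R : realType) (X Q : metricType R) (phi : X -> Q) kp L r r'
    x y z p : r' <= r -> witness phi kp L r r' x y p ->
  witness phi kp L r r' x z p \/ exists s p1 p2, [/\ mdist p p1 <= L /\ mdist p p2 <= L,
    linked kp (far s r) (phi x) (phi p1), linked kp (far s r) (phi y) (phi p2),
    ~ linked kp (far s r') (phi x) (phi y) &
    ~ linked kp (far s r) (phi y) (phi z)].
Proof.
move=> r'r [s [p1 [p2 [pp1 pp2 xp1 yp2 xy]]]].
have [yz|yz] := pselect (linked kp (far s r) (phi y) (phi z)); [left|right].
  exists s, p1, p2; split=> //; first exact: linked_trans (linked_sym yz) yp2.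
  move=> xz; apply: xy; apply: linked_trans xz _; apply: linked_sym.
  by apply: linked_mono yz => q; rewrite /far /=; lra.
by exists s, p1, p2.
Qed.

Definition cylinder (R : realType) (X : metricType R) (I : Type)
    (Q : I -> metricType R) (phi : forall i, X -> Q i) (kp : I -> R) (L r r' : R)
    (x y : X) : set X :=
  [set p | [\/ mdist x p <= L, mdist y p <= L |
    exists i, witness (phi i) (kp i) L r r' x y p]].

Section Cylinder.
Variables (R : realType) (X : metricType R) (I : Type) (Q : I -> metricType R)
  (phi : forall i, X -> Q i) (kp : I -> R) (m : nat) (Q' : 'I_m -> metricType R)
  (f : forall j, X -> Q' j) (k k0 dX c1 K E D0 Lb L : R).
Arguments phi : clear implicits.
Arguments f : clear implicits.

(** [c0] and [c2] come from one and two uses of [gp_ordered]. The gap between [r'] and [r] absorbs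
    the errors of the separation lemmas and leaves more than [D0]. [Lam] bounds the distance from
    [p] to the projections of [p1] and [p2]. *)
Let c0 := 4 * c1 + 2 * dX.
Let c2 := 4 * c0 + 2 * dX.
Let r' := 4 * K + 1.
Let r := r' + D0 + 30 * E + 40 * K + 1.
Let theta := L + c1 + dX.
Let Lam := 2 * L + theta + 3 * c1.
Let rad := 4 * c2 + 6 * Lam.

Hypotheses (k_k0 : k <= k0) (k00 : 0 <= k0) (dX0 : 0 <= dX) (c10 : 0 <= c1)
  (k_c1 : 3 / 2 * k0 <= c1) (K0 : 0 <= K) (E0 : 0 <= E) (D00 : 0 <= D0)
  (Lb0 : 0 <= Lb) (L_Lb : Lb + 3 * k0 <= L).
Hypotheses (X_hyp : gp_hyperbolic X dX)
  (X_geod : roughly_geodesic_with k X)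
  (X_center : forall x y p S, rough_geodesic k x y S ->
     exists q, [/\ S q, gp q x y <= c1, gp q x (p : X) <= c1 & gp q y p <= c1])
  (Q_tree : forall i, treelike (Q i) (kp i) K)
  (phi_between : forall i q x y, gp q x y <= c2 ->
     gp (phi i q) (phi i x) (phi i y) <= E)
  (f_between : forall j q x y, gp q x y <= c2 -> gp (f j q) (f j x) (f j y) <= E)
  (phi_f : forall i u v, D0 < mdist (phi i u) (phi i v) -> exists j, forall u v,
     mdist (phi i u) (phi i v) <= mdist (f j u) (f j v) + K /\
     mdist (f j u) (f j v) <= mdist (phi i u) (phi i v) + K)
  (phi_big : forall u v, Lb <= mdist u v ->
     exists i, 2 * r + 2 * E + 10 * K < mdist (phi i u) (phi i v)).

Ltac consts :=
  have := k_k0; have := k00; have := dX0; have := c10; have := k_c1; have := K0;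
  have := E0; have := D00; have := Lb0; have := L_Lb;
  move=> ? ? ? ? ? ? ? ? ? ?.

Let Q_hyp i : gp_hyperbolic (Q i) K. Proof. by have [] := Q_tree i. Qed.

Local Notation Wit i := (witness (phi i) (kp i) L r r').
Local Notation C := (cylinder phi kp L r r').

Lemma rough_geodesic_sub_cylinder x y S : rough_geodesic k x y S -> S `<=` C x y.
Proof.
consts; move=> xyS p Sp; have k_ge0 := rough_geodesic_ge0 xyS.
have [|xp] := leP (mdist x p) L; first by constructor 1.
have [|yp] := leP (mdist y p) L; first by constructor 2.
constructor 3.
have [len [g [len0 g0 glen gS SP]]] := rough_geodesicP xyS.
have [t /andP[t0 tlen] pt] := (SP p).1 Sp.
have t1 : L - k < t by have := gS 0 t (lexx _) t0 tlen; rewrite g0 -pt; lra.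
have t2 : L - k < len - t.
  by have := gS t len t0 tlen (lexx _); rewrite glen -pt (metric_sym p y); lra.
(* The shift [L - k] keeps [p1] and [p2] within [L] of [p] despite the error [k], and within the
   parameter interval. *)
pose t1' := t - (L - k); pose t2' := t + (L - k).
have [t1E t2E] : t1' = t - (L - k) /\ t2' = t + (L - k) by [].
pose p1 := g t1'; pose p2 := g t2'.
have x1 : t1' - 0 - k <= mdist x p1 <= t1' - 0 + k by rewrite -g0; apply: gS; lra.
have x2 : t2' - 0 - k <= mdist x p2 <= t2' - 0 + k by rewrite -g0; apply: gS; lra.
have y1 : len - t1' - k <= mdist p1 y <= len - t1' + k by rewrite -glen; apply: gS; lra.
have y2 : len - t2' - k <= mdist p2 y <= len - t2' + k by rewrite -glen; apply: gS; lra.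
have p12 : t2' - t1' - k <= mdist p1 p2 <= t2' - t1' + k by apply: gS; lra.
have pp1 : t - t1' - k <= mdist p1 p <= t - t1' + k by rewrite pt; apply: gS; lra.
have pp2 : t2' - t - k <= mdist p p2 <= t2' - t + k by rewrite pt; apply: gS; lra.
have [|i big] := phi_big (u := p1) (v := p2); first lra.
exists i.
have g1 : gp p1 x p2 <= c2 by rewrite /gp (metric_sym p1 x) /c2 /c0; lra.
have g2 : gp p2 y p1 <= c2.
  by rewrite /gp (metric_sym p2 p1) (metric_sym y p1) /c2 /c0; lra.
have r1 : 4 * K < r' by rewrite /r'; lra.
have r2 : r' <= r by rewrite /r; lra.
have [s [s1 s2 s3]] := separation_exists (@Q_hyp i) (r := r) (r' := r') (Q_tree i)
   (phi_between i g1) (phi_between i g2) E0 K0 r1 r2 big.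
exists s, p1, p2; split=> //; first by rewrite metric_sym; lra.
lra.
Qed.

(** If [p] were far from its projection [q], then [q] would be between [x] and [p1] and between [y]
    and [p2], as well as between [x] and [y], which [separation_contra] excludes in the
    quasitree. *)
Lemma cylinder_sub_nbhd x y S : rough_geodesic k x y S -> C x y `<=` mnbhd theta S.
Proof.
consts; move=> xyS p; have [Sx Sy] := rough_geodesic_ends xyS.
move=> [xp|yp|[i [s [p1 [p2 [pp1 pp2 xp1 yp2 nxy]]]]]].
- by exists x => //; rewrite metric_sym /theta; lra.
- by exists y => //; rewrite metric_sym /theta; lra.
have [q [Sq qxy qxp qyp]] := X_center p xyS.
exists q => //; rewrite leNgt; apply/negP => pq.
have away p' x' : mdist p p' <= L -> gp q x' p <= c1 -> gp q x' p' <= c2.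
  move=> pp' qx'p; have := X_hyp q x' p' p; have := gp_move q p p p'.
  rewrite gpxx (gpC q p' p) (metric_sym q p) => ? -[?|?]; first by rewrite /c2 /c0; lra.
  by move: pq; rewrite /theta; lra.
have [_ F1 F2 _] := Q_tree i.
have sxy : gp s (phi i x) (phi i y) <= r' + K.
  by rewrite leNgt; apply/negP => sxy; apply/nxy/F1/ltW.
have rE : r' + K + 2 * E + 3 * K < r - K by rewrite /r; lra.
have qE : gp (phi i q) (phi i x) (phi i y) <= E.
  by apply: phi_between; rewrite /c2 /c0; lra.
exact: (separation_contra (@Q_hyp i) qE (phi_between i (away p1 x pp1 qxp))
  (phi_between i (away p2 y pp2 qyp)) sxy
  (F2 _ _ _ _ xp1) (F2 _ _ _ _ yp2) rE E0 K0).
Qed.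

Lemma center_dist q p (x y : X) A : gp q x p <= A -> gp q y p <= A ->
  mdist p q <= gp p x y + 2 * A.
Proof.
have := metric_triangle x q y.
rewrite /gp (metric_sym q x) (metric_sym q y) (metric_sym q p).
by rewrite (metric_sym p x) (metric_sym p y); lra.
Qed.

Let dist_ordered (u v x : X) A B : gp u x v <= A -> mdist x v <= mdist x u + B ->
  mdist u v <= 2 * A + B.
Proof. by rewrite /gp (metric_sym u x); lra. Qed.

(** The bound [5 * E + 7 * K] of [separation_at_branch] for [w2], with [B = r - K] and [C = r + K],
    plus the [K] lost in passing from [phi i] to [f j]. *)
Let M := 5 * E + 8 * K.

(* [p] lies near the point where the [j]th projection of the geodesic from [x]
   to [c] comes close to that of [c] for good. *)
Definition stuck (x c : X) (j : 'I_m) (p : X) : Prop :=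
  exists q1 q2, [/\ gp q1 x c <= c0 /\ gp q2 x c <= c0, mdist p q1 <= Lam,
    mdist p q2 <= Lam, mdist (f j q2) (f j c) <= M &
    M + 2 * E < mdist (f j q1) (f j c)].

Let c00 : 0 <= c0. Proof. by consts; rewrite /c0; lra. Qed.

(** If [q2] came first, [f j q1] would be coarsely between [f j q2] and [f j c], hence too close to
    [f j c]. *)
Lemma stuck_order x c j q1 q2 : gp q1 x c <= c0 -> gp q2 x c <= c0 ->
  mdist (f j q2) (f j c) <= M -> M + 2 * E < mdist (f j q1) (f j c) ->
  mdist x q1 <= mdist x q2 /\ gp q1 x q2 <= c2.
Proof.
move=> q1c q2c q2M q1M; have q12 : mdist x q1 <= mdist x q2.
  rewrite leNgt; apply/negP => q21.
  have q21' : mdist x q2 <= mdist x q1 + 0 by rewrite addr0 ltW.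
  have [_] := gp_ordered dX0 X_hyp c00 (lexx _) q2c q1c q21'.
  rewrite addr0 => /(f_between j); rewrite /gp.
  have := metric_triangle (f j q2) (f j q1) (f j c).
  have := mdist_ge0 (f j q1) (f j q2); lra.
split=> //; have q12' : mdist x q1 <= mdist x q2 + 0 by rewrite addr0.
by have [] := gp_ordered dX0 X_hyp c00 (lexx _) q1c q2c q12'; rewrite addr0.
Qed.

(** By [stuck_order] the far point of each pair precedes the near point of the other, while each
    pair has diameter at most [2 * Lam]. *)
Lemma stuck_close x c j p p' : stuck x c j p -> stuck x c j p' -> mdist p p' <= rad.
Proof.
move=> [q1 [q2 [[q1c q2c] pq1 pq2 q2M q1M]]] [s1 [s2 [[s1c s2c] ps1 ps2 s2M s1M]]].
have [xs1q2 gs1q2] := stuck_order s1c q2c q2M s1M.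
have [xq1s2 _] := stuck_order q1c s2c s2M q1M.
have := mdist_ge0 p q1; have := mdist_ge0 x q1.
have := metric_triangle p q2 p'; have := metric_triangle q2 s1 p'.
have := metric_triangle x q1 q2; have := metric_triangle q1 p q2.
have := metric_triangle x s1 s2; have := metric_triangle s1 p' s2.
move: gs1q2; rewrite /gp (metric_sym s1 x) (metric_sym s1 q2) (metric_sym q1 p).
by rewrite (metric_sym s1 p') /rad; consts; have := c00; rewrite /c2; lra.
Qed.

Lemma cylinder_change x y z c p : gp c x y <= c1 -> gp c y z <= c1 -> gp c x z <= c1 ->
  mdist x p <= gp x y z -> C x y p ->
  [\/ C x z p, mdist c p <= rad | exists j, stuck x c j p].
Proof.
consts; have ? := c00; move=> cxy cyz cxz xp.
have Lam0 : 0 <= Lam by rewrite /Lam /theta; lra.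
have xc : gp x y z <= mdist x c + c1 by have := gp_base x c y z; lra.
move=> [xpL|ypL|[i Wi]].
- by constructor 1; constructor 1.
(* As [p] is hardly further from [x] than [c] is, being near [y] forces both [y] and [p] to be near
   [c]. *)
- constructor 2; have := metric_triangle c y p; have := metric_triangle x p y.
  move: cxy; rewrite /gp (metric_sym c x) (metric_sym p y).
  by rewrite /rad /c2 /c0 /Lam /theta; lra.
have r'r : r' <= r by rewrite /r; lra.
have [Wz|[s [p1 [p2 [[pp1 pp2] xp1 yp2 nxy nyz]]]]] := witness_change z r'r Wi.
  by constructor 1; constructor 3; exists i.
have [S xyS] := X_geod x y.
have [q0 Sq0 pq0] : mnbhd theta S p.
  by apply: cylinder_sub_nbhd xyS _ _; constructor 3; exists i.
have q0xy : gp q0 x y <= c1.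
  by have := rough_geodesic_gp xyS Sq0; lra.
have proj p' : mdist p p' <= L -> exists q, [/\ gp q x y <= c1, gp q x p' <= c1,
    gp q y p' <= c1 & mdist p q <= Lam].
  move=> pp'; have [q [_ qxy qxp qyp]] := X_center p' xyS.
  exists q; split=> //; have := center_dist qxp qyp; have := gp_base p' p x y.
  have := gp_base p q0 x y; have := metric_triangle p p' q; rewrite (metric_sym p' p).
  by rewrite /Lam; lra.
have [q1 [q1xy q1x q1y pq1]] := proj p1 pp1.
have [q2 [q2xy q2x q2y pq2]] := proj p2 pp2.
have [pc|pc] := leP (mdist c p) rad; first by constructor 2.
(* A projection beyond [c] would be close to [c], since [p] is hardly further from [x] than [c]; but
   [p] is now far from [c]. *)
have before q : gp q x y <= c1 -> mdist p q <= Lam -> gp q x c <= c0.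
  move=> qxy pq; have [qc|qc] := leP (mdist x q) (mdist x c).
    have qc' : mdist x q <= mdist x c + 0 by rewrite addr0.
    by have [] := gp_ordered dX0 X_hyp c10 (lexx _) qxy cxy qc'; rewrite addr0.
  have qc' : mdist x c <= mdist x q + 0 by rewrite addr0 ltW.
  have [] := gp_ordered dX0 X_hyp c10 (lexx _) cxy qxy qc'; rewrite addr0 => cxq _.
  have := metric_triangle x p q; have := metric_triangle c q p.
  rewrite (metric_sym q p) => cqp xpq.
  have cq : mdist x q <= mdist x c + (c1 + Lam) by lra.
  by move: (dist_ordered cxq cq) pc; rewrite /rad /c2 /c0; lra.
have q1c := before q1 q1xy pq1; have q2c := before q2 q2xy pq2.
have c1c2 : c1 <= c2 by rewrite /c2 /c0; lra.
have c0c2 : c0 <= c2 by rewrite /c2; lra.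
have btw q a b : gp q a b <= c1 -> gp (phi i q) (phi i a) (phi i b) <= E.
  by move=> qab; apply: phi_between; lra.
have btw0 q a b : gp q a b <= c0 -> gp (phi i q) (phi i a) (phi i b) <= E.
  by move=> qab; apply: phi_between; lra.
have [_ F1 F2 _] := Q_tree i.
have sxy : gp s (phi i x) (phi i y) <= r' + K.
  by rewrite leNgt; apply/negP => sxy; apply/nxy/F1/ltW.
have syz : gp s (phi i y) (phi i z) <= r + K.
  by rewrite leNgt; apply/negP => syz; apply/nyz/F1/ltW.
have rE : r' + K + 10 * E + 10 * K < r - K by rewrite /r; lra.
have [near2 far1] := separation_at_branch (@Q_hyp i)
  (btw _ _ _ q1xy) (btw _ _ _ q1x) (btw _ _ _ q1y)
  (btw _ _ _ q2xy) (btw _ _ _ q2x) (btw _ _ _ q2y) (btw0 _ _ _ q2c)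
  (btw _ _ _ cxy) (btw _ _ _ cxz) sxy (F2 _ _ _ _ xp1) (F2 _ _ _ _ yp2) syz rE E0 K0.
(* The images of [q1] and [c] are more than [D0] apart, so distances under [phi i] agree up to [K]
   with those under a single [f j]. *)
have [|j fj] := @phi_f i q1 c; first by move: far1; rewrite /r; lra.
constructor 3; exists j, q1, q2; split=> //.
  by have [_] := fj q2 c; rewrite /M; lra.
by have [+ _] := fj q1 c; move: far1; rewrite /M /r; lra.
Qed.

Lemma cylinder_globally_stable : globally_stable (2 * m + 1) rad C.
Proof.
split=> [x y|x y z].
  by apply/seteqP; split=> p [?|?|[i /witness_sym Wi]];
    by [constructor 2|constructor 1|constructor 3; exists i].
have [S xyS] := X_geod x y; have [c [_ cxy cxz cyz]] := X_center z xyS.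
have /boolp.choice[h hP] : forall j, exists q, forall p,
    stuck x c j p -> mdist q p <= rad.
  move=> j.
  have [[q stq]|nst] := pselect (exists q, stuck x c j q).
    by exists q => p; apply: stuck_close.
  by exists c => p stp; case: nst; exists p.
have hm : (m < 2 * m + 1)%N by rewrite addn1 ltnS leq_pmull.
have hj (j : 'I_m) : (j < 2 * m + 1)%N by apply: ltn_trans hm.
(* Indices below [m] carry the stuck points; all others default to [c]. *)
pose cs (n : 'I_(2 * m + 1)) := oapp h c (insub (n : nat) : option 'I_m).
exists cs.
have half y' z' p : gp c x y' <= c1 -> gp c y' z' <= c1 -> gp c x z' <= c1 ->
    mdist x p <= gp x y' z' -> C x y' p ->
    ~ (\bigcup_n mball (cs n) rad) p ->
    C x z' p.
  move=> cxy' cyz' cxz' xp Cp nb.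
  have [//|cp|[j stp]] := cylinder_change cxy' cyz' cxz' xp Cp; case: nb.
    by exists (Ordinal hm) => //; rewrite /cs insubF //= ltnn.
  by exists (Ordinal (hj j)) => //; rewrite /cs valK; apply: hP.
apply/seteqP; split=> p [[Cp xp] nb]; split=> //; split=> //.
  exact: half cxy cyz cxz xp Cp nb.
rewrite gpC in cyz; have xp' : mdist x p <= gp x z y by rewrite gpC.
exact: half cxz cyz cxy xp' Cp nb.
Qed.

End Cylinder.

(** * The group action *)

(** An infimum of natural numbers below [m + 1] is witnessed by some [n <= m], and being a lower
    bound it gives [m <= n]. *)
Lemma strong_quasitree_rank_attained (R : realType) (G : groupType)
    (X : metricType R) (aX : isometric_action G X) (m : nat) :
  strong_quasitree_rank aX = (m%:R)%:E -> strong_quasitree_embedding aX m.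
Proof.
move=> rk; have := rk; rewrite /strong_quasitree_rank => infE.
have : (ereal_inf [set (n%:R)%:E | n in strong_quasitree_embedding aX] <
    (m.+1%:R : R)%:E)%E by rewrite infE lte_fin ltr_nat.
move=> /ereal_inf_lt[_ [n embn <-]]; rewrite lte_fin ltr_nat ltnS => nm.
have : ((m%:R : R)%:E <= (n%:R)%:E)%E.
  by rewrite -infE; apply: ereal_inf_lbound; exists n.
rewrite lee_fin ler_nat => mn; suff -> : m = n by [].
by apply/eqP; rewrite eqn_leq mn.
Qed.

Lemma ord_uniform (R : realType) (m : nat) (P : 'I_m -> R -> Prop) :
  (forall i, exists r, P i r) -> (forall i r r', r <= r' -> P i r -> P i r') ->
  exists2 r, 0 <= r & forall i, P i r.
Proof.
move=> /boolp.choice[h hP] mono; exists (\sum_(i < m) `|h i|).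
  by apply: sumr_ge0 => i _.
move=> i; apply: mono (hP i); rewrite (bigD1 i) //=.
apply: le_trans (ler_norm _) _; rewrite lerDl; exact: sumr_ge0.
Qed.

Section Action.
Variables (R : realType) (G : groupType) (X : metricType R)
  (aX : isometric_action G X).

Lemma iactVK g : cancel (aX g) (aX g^-1%g).
Proof. by move=> x; rewrite -iactM mulVg iact1. Qed.

Lemma iactKV g : cancel (aX g^-1%g) (aX g).
Proof. by move=> x; rewrite -iactM mulgV iact1. Qed.

Lemma gp_iact g w x y : gp (aX g w) (aX g x) (aX g y) = gp w x y.
Proof. by rewrite /gp !iact_isometry. Qed.

Variables (m : nat) (Q : 'I_m -> metricType R) (f : X -> l1_prod Q).

(** Ranging over all of [G] makes the family closed under precomposition with the action, hence the
    cylinders invariant. *)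
Definition translate (i : 'I_m * G) (x : X) : Q i.1 := f (aX i.2 x) i.1.

Lemma cylinder_invariant kp L r r' :
  invariant_cylinders aX (cylinder translate (fun i => kp i.1) L r r').
Proof.
have half g x y p :
    cylinder translate (fun i => kp i.1) L r r' (aX g x) (aX g y) (aX g p) ->
    cylinder translate (fun i => kp i.1) L r r' x y p.
  move=> [|| [[i h] [s [p1 [p2 [pp1 pp2 xp1 yp2 xy]]]]]].
  - by rewrite iact_isometry; constructor 1.
  - by rewrite iact_isometry; constructor 2.
  constructor 3; exists (i, h * g)%g, s, (aX g^-1%g p1), (aX g^-1%g p2).
  have trE z : translate (i, h * g)%g z = translate (i, h) (aX g z).
    by rewrite /translate /= iactM.
  rewrite !trE !iactKV; split=> //.
    by rewrite -(iact_isometry aX g) iactKV.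
  by rewrite -(iact_isometry aX g) iactKV.
move=> g x y; apply/seteqP; split=> [p Cp|_ [p Cp <-]].
  by exists (aX g^-1%g p); rewrite ?iactKV //; apply: (half g); rewrite iactKV.
by apply: (half g^-1%g); rewrite !iactVK.
Qed.

End Action.

Theorem theorem5p8 (R : realType) (G : groupType) (X : metricType R)
    (aX : isometric_action G X) (delta : R) (m : nat)
    (X_rough : roughly_geodesic_with delta X)
    (X_hyp : hyperbolic X)
    (X_rank : strong_quasitree_rank aX = (m%:R)%:E) :
  exists r theta : R, 0 <= theta /\
    exists C : X -> X -> set X,
      [/\ forall x y, is_cylinder delta theta x y (C x y),
          globally_stable (2 * m + 1)%N r C &
          invariant_cylinders aX C].
Proof.
have [Q [aQ [muX [muQ [f]]]]] := strong_quasitree_rank_attained X_rank.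
move=> [Qqt [muXP muQP] f_equi [qmd f_qm] [l [c [l1 c0 f_qi]]]].
have l0 : 0 < l by lra.
have linv0 : 0 < l^-1 by rewrite invr_gt0.
have f_low u v : l^-1 * mdist u v - c <= mdist (f u) (f v).
  by have /andP[] := f_qi u v I I.
have f_up u v : mdist (f u) (f v) <= l * mdist u v + c.
  by have /andP[] := f_qi u v I I.
have /boolp.choice[kp kpP] : forall i, exists kp K, 0 <= K /\ treelike (Q i) kp K.
  by move=> i; have [qt rg] := Qqt i; apply: quasitree_treelike.
have [K K0 Q_tree] : exists2 K, 0 <= K & forall i, treelike (Q i) (kp i) K.
  apply: ord_uniform => [i|i r r' rr']; last exact: treelike_mono.
  by have [K [_ KP]] := kpP i; exists K.
have [dX dX0 hypX] := hyperbolic_gp X_hyp.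
pose k0 := `|delta|; have k00 : 0 <= k0 by apply: normr_ge0.
have dk0 : delta <= k0 by apply: ler_norm.
pose c1 := 5 * k0 + 2 * dX; have c1E : c1 = 5 * k0 + 2 * dX by [].
have c10 : 0 <= c1 by lra.
have center x y p S : rough_geodesic delta x y S ->
    exists q : X, [/\ S q, gp q x y <= c1, gp q x p <= c1 & gp q y p <= c1].
  move=> xyS; have [q [Sq ? ? ?]] := rough_geodesic_center p dX0 hypX xyS.
  by exists q; split=> //; lra.
pose c2 := 4 * (4 * c1 + 2 * dX) + 2 * dX.
have [E E0 f_btw] : exists2 E, 0 <= E & forall j q x y, gp q x y <= c2 ->
    gp (f q j) (f x j) (f y j) <= E.
  apply: (@ord_uniform R m (fun j E => forall q x y, gp q x y <= c2 ->
    gp (f q j) (f x j) (f y j) <= E)) => [j|j r r' rr' H q x y /H]; last first.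
    by move=> /le_trans; apply.
  have [_ [kQ Qg]] := Qqt j.
  apply: (quasimedian_between (f := fun x => f x j) X_rough Qg muXP (muQP j) (ltW l0)).
    by move=> x y; apply: le_trans (l1_dist_coord j _ _) (f_up x y).
  by move=> x y z; apply: le_trans (f_qm x y z); apply: (l1_dist_coord j).
pose D0 := m%:R * (3 * K).
have D00 : 0 <= D0 by apply: mulr_ge0 => //; lra.
pose r' := 4 * K + 1; pose r := r' + D0 + 30 * E + 40 * K + 1.
pose B := 2 * r + 2 * E + 10 * K; have B0 : 0 <= B by rewrite /B /r /r'; lra.
(* Points this far apart have images more than [m%:R * B] apart in the product, so some coordinate
   exceeds [B]. *)
pose Lb := l * (m%:R * B + c) + 1.
have Lb0 : 0 <= Lb.
  apply: addr_ge0 => //; apply: mulr_ge0; first lra.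
  by apply: addr_ge0 => //; apply: mulr_ge0.
pose L := Lb + 3 * k0; have LE : Lb + 3 * k0 <= L by [].
have phi_btw (i : 'I_m * G) q x y : gp q x y <= c2 ->
    gp (translate aX f i q) (translate aX f i x) (translate aX f i y) <= E.
  by rewrite -(gp_iact aX i.2) => /(f_btw i.1).
have phi_f (i : 'I_m * G) u v :
    D0 < mdist (translate aX f i u) (translate aX f i v) -> exists j, forall u v,
     mdist (translate aX f i u) (translate aX f i v) <= mdist (f u j) (f v j) + K /\
     mdist (f u j) (f v j) <= mdist (translate aX f i u) (translate aX f i v) + K.
  (* By equivariance the translate is a coordinate of an isometry of the product applied to [f]. *)
  rewrite /translate !f_equi => uv.
  have Q_hyp j : gp_hyperbolic (Q j) K by have [] := Q_tree j.
  have [j jP] := isometry_permutes_coord Q_hyp (@iact_isometry _ _ _ aQ i.2)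
    (iactKV aQ i.2) (iactVK aQ i.2) uv.
  by exists j => a b; rewrite !f_equi; apply: jP.
have phi_big u v : Lb <= mdist u v -> exists i : 'I_m * G,
    B < mdist (translate aX f i u) (translate aX f i v).
  move=> uv; apply: contrapT => /forallNP small.
  have : mdist (f u) (f v) <= m%:R * B.
    rewrite l1_distE; apply: le_trans (_ : \sum_(j < m) B <= _).
      apply: ler_sum => j _; rewrite leNgt; apply/negP => Bj.
      by apply: (small (j, 1%g)); rewrite /translate /= !iact1.
    by rewrite sumr_const card_ord [leRHS]mulr_natl.
  have := f_low u v => low up.
  have {low up} H : l^-1 * mdist u v <= m%:R * B + c by lra.
  have := real_ler_pM2l l0 H; rewrite mulrA divff ?gt_eqF // mul1r.
  by move: uv; rewrite /Lb; lra.
(* These are [rad] and [theta] of the cylinder construction, unfolded. *)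
exists (4 * c2 + 6 * (2 * L + (L + c1 + dX) + 3 * c1)), (L + c1 + dX).
split; first by move: LE; lra.
exists (cylinder (translate aX f) (fun i => kp i.1) L r r').
have k0c1 : 3 / 2 * k0 <= c1 by lra.
have Q_tree' (i : 'I_m * G) : treelike (Q i.1) (kp i.1) K by [].
split.
- move=> x y S xyS; split.
    exact: (rough_geodesic_sub_cylinder dk0 k00 dX0 c10 k0c1 K0 E0 D00 Lb0 LE
      Q_tree' phi_btw phi_big).
  exact: (cylinder_sub_nbhd dk0 k00 dX0 c10 k0c1 K0 E0 D00 Lb0 LE hypX center
    Q_tree' phi_btw).
- exact: (cylinder_globally_stable (f := fun j x => f x j) dk0 k00 dX0 c10 k0c1
    K0 E0 D00 Lb0 LE hypX X_rough center Q_tree' phi_btw f_btw phi_f).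
exact: cylinder_invariant.
Qed.
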